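(* Let $X$ and $Y$ be open sets in $\mathbb{R}^n$ and let $c(x,y)=\Psi(x-y)$ be a $\Psi$-cost on $X\times Y$, where $\Psi:\mathcal{M}\to\mathbb{R}$ is a convex function on an open domain $\mathcal{M}\subset\mathbb{R}^n$ containing $X-Y$. Let $(T\mathcal{M},g^D,J)$ be the Kähler Sasaki metric associated with the Hessian manifold $(\mathcal{M},\Psi)$ and let $R_{g^D}$ be its Riemannian curvature tensor. Then for all $(x,y)\in X\times Y$, every vector $\xi$ and every covector $\eta$ with $\eta(\xi)=0$, the MTW tensor of $c$ satisfies $$\mathfrak{S}_{(x,y)}(\xi,\eta)=2R_{g^D}(\xi,J\eta^\sharp,\xi,J\eta^\sharp)-2R_{g^D}(\eta^\sharp,\xi,\eta^\sharp,\xi),$$ where the right-hand side is evaluated at points of $T\mathcal{M}$ lying over $x-y\in\mathcal{M}$. Furthermore, the same formula holds for the cross-curvature, i.e. for the same expression $\mathfrak{S}_{(x,y)}(\xi,\eta)$ with $\xi$ and $\eta$ an arbitrary vector and covector (not necessarily satisfying $\eta(\xi)=0$).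
   Context: $X-Y=\{x-y: x\in X, y\in Y\}$. A $\Psi$-cost is a cost function $c:X\times Y\to\mathbb{R}$ of the form $c(x,y)=\Psi(x-y)$ with $\Psi:\mathcal{M}\to\mathbb{R}$ convex on an open domain $\mathcal{M}\supset X-Y$. The function $\Psi$ is $C^4$ with positive definite Hessian. MTW tensor: write $c_{I,J}=\partial_{x^I}\partial_{y^J}c$ for multi-indices $I,J$, and let $c^{i,j}$ be the matrix inverse of the mixed derivative $c_{i,j}$. For a vector $\xi$ and covector $\eta$, $$\mathfrak{S}_{(x,y)}(\xi,\eta)=\sum_{i,j,k,l,p,q,r,s}(c_{ij,p}c^{p,q}c_{q,rs}-c_{ij,rs})\,c^{r,k}c^{s,l}\,\xi^i\xi^j\eta_k\eta_l .$$ The MTW tensor is this expression restricted to pairs with $\eta(\xi)=0$; the cross-curvature is the same expression for arbitrary pairs. Hessian manifold and Sasaki metric: let $u^1,\dots,u^n$ be the Euclidean coordinates on $\mathcal{M}$, let $g_{ij}=\Psi_{ij}=\partial_{u^i}\partial_{u^j}\Psi$ be the Riemannian metric on $\mathcal{M}$, and let $D$ be the flat connection given by differentiation in the $u$-coordinates. On $T\mathcal{M}$ use coordinates $(u^i,v^i)$, where $(u,v)$ denotes the tangent vector $v^i\partial_{u^i}$ at $u$. The Sasaki metric is the Kähler structure with complex structure $J\partial_{u^i}=\partial_{v^i}$, $J\partial_{v^i}=-\partial_{u^i}$ and Riemannian metric $g^D(\partial_{u^i},\partial_{u^j})=g^D(\partial_{v^i},\partial_{v^j})=\Psi_{ij}(u)$,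 $g^D(\partial_{u^i},\partial_{v^j})=0$. The covector $\eta$ is converted to a vector by $(\eta^\sharp)^i=\Psi^{ij}\eta_j$, where $\Psi^{ij}$ is the inverse matrix of $\Psi_{ij}$ at $x-y$. A vector $\xi=\xi^i\partial_{u^i}$ on $\mathcal{M}$ is extended to $T\mathcal{M}$ as the vector with the same expression $\xi^i\partial_{u^i}$ in the coordinates $(u,v)$, and likewise for $\eta^\sharp$. The sign convention for the curvature tensor is that $R(A,B,A,B)$ equals the sectional curvature of the plane spanned by $A,B$ times $|A|^2|B|^2-\langle A,B\rangle^2$. *)

(* Defs.v *)
From HB Require Import structures.
From mathcomp Require Import all_boot all_order all_algebra.
From mathcomp Require Import all_classical all_reals all_analysis.

Set Implicit Arguments.
Unset Strict Implicit.
Unset Printing Implicit Defensive.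

Import Order.TTheory GRing.Theory Num.Theory.
Import numFieldNormedType.Exports.

Local Open Scope classical_set_scope.
Local Open Scope ring_scope.

(* Points and (tangent) vectors of R^n are row vectors 'rV[R]_n; covectors are
   column vectors 'cV[R]_n. *)

Definition pairing (R : realType) (n : nat) (eta : 'cV[R]_n) (xi : 'rV[R]_n) : R :=
  (xi *m eta) 0 0.

Definition partial (R : realType) (n : nat) (i : 'I_n) (f : 'rV[R]_n -> R)
    (u : 'rV[R]_n) : R :=
  'D_(delta_mx 0 i) f u.

(* C^k regularity on M, which is meant to be open: all iterated partial
   derivatives of order at most k exist and are continuous on M. *)
Fixpoint is_Ck (R : realType) (n : nat) (k : nat) (M : set 'rV[R]_n)
    (f : 'rV[R]_n -> R) : Prop :=
  (forall u, M u -> {for u, continuous f}) /\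
  if k is k'.+1 then
    forall i : 'I_n,
      (forall u, M u -> derivable f u (delta_mx 0 i)) /\
      is_Ck k' M (partial i f)
  else True.

(* M itself is not required to be convex: f is convex on M when its restriction
   to every convex subset of M is convex.  For a convex M this is the usual
   convexity of f on M; in general it is the convexity inequality along every
   segment contained in M. *)
Definition convex_on (R : realType) (n : nat) (M : set 'rV[R]_n)
    (f : 'rV[R]_n -> R) : Prop :=
  forall C : set 'rV[R]_n, convex_set C -> C `<=` M -> convex_function C f.

Definition hess (R : realType) (n : nat) (f : 'rV[R]_n -> R) (u : 'rV[R]_n) :
    'M[R]_n :=
  \matrix_(i, j) partial i (partial j f) u.

Definition posdefmx (R : realType) (n : nat) (A : 'M[R]_n) : Prop :=
  forall v : 'rV[R]_n, v != 0 -> 0 < (v *m A *m v^T) 0 0.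

(* Functions on X x Y and on M are represented by total functions; only their
   values on X x Y and on M are constrained. *)
Record is_Psi_cost (R : realType) (n : nat) (X Y M : set 'rV[R]_n)
    (Psi : 'rV[R]_n -> R) (c : 'rV[R]_n -> 'rV[R]_n -> R) : Prop :=
  IsPsiCost {
    Psi_cost_open : open M;
    Psi_cost_sub : [set x - y | x in X & y in Y] `<=` M;
    Psi_cost_convex : convex_on M Psi;
    Psi_cost_C4 : is_Ck 4 M Psi;
    Psi_cost_posdef : forall u, M u -> posdefmx (hess Psi u);
    Psi_costE : forall x y, X x -> Y y -> c x y = Psi (x - y)
  }.

Definition dx (R : realType) (n : nat) (i : 'I_n)
    (c : 'rV[R]_n -> 'rV[R]_n -> R) : 'rV[R]_n -> 'rV[R]_n -> R :=
  fun x y => partial i (fun x' => c x' y) x.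

Definition dy (R : realType) (n : nat) (i : 'I_n)
    (c : 'rV[R]_n -> 'rV[R]_n -> R) : 'rV[R]_n -> 'rV[R]_n -> R :=
  fun x y => partial i (c x) y.

(* The first index of the inverse cinv of the mixed Hessian c_{i,j} is a
   y-index and the second one an x-index.  The indices p, q occur only in the
   product term, so they are summed there and not over c_{ij,rs}. *)
Definition MTW (R : realType) (n : nat) (c : 'rV[R]_n -> 'rV[R]_n -> R)
    (x y : 'rV[R]_n) (xi : 'rV[R]_n) (eta : 'cV[R]_n) : R :=
  let cinv : 'M[R]_n := invmx (\matrix_(i, j) dx i (dy j c) x y) in
  \sum_i \sum_j \sum_k \sum_l \sum_r \sum_s
    ((\sum_p \sum_q
        dx i (dx j (dy p c)) x y * cinv p q * dx q (dy r (dy s c)) x y)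
     - dx i (dx j (dy r (dy s c))) x y)
    * cinv r k * cinv s l * xi 0 i * xi 0 j * eta k 0 * eta l 0.

(* A Riemannian metric on an open subset of R^m is given by its matrix G in the
   Euclidean coordinates.  christoffel G k i j is Gamma^k_{ij} of the
   Levi-Civita connection. *)
Definition christoffel (R : realType) (m : nat) (G : 'rV[R]_m -> 'M[R]_m)
    (k i j : 'I_m) (u : 'rV[R]_m) : R :=
  2^-1 * \sum_l invmx (G u) k l *
    (partial i (fun u' => G u' j l) u + partial j (fun u' => G u' i l) u
     - partial l (fun u' => G u' i j) u).

(* The l-th component of R(d_i, d_j) d_k, where
   R(A, B) C = nabla_A nabla_B C - nabla_B nabla_A C - nabla_[A, B] C. *)
Definition curv_coef (R : realType) (m : nat) (G : 'rV[R]_m -> 'M[R]_m)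
    (l i j k : 'I_m) (u : 'rV[R]_m) : R :=
  partial i (christoffel G l j k) u - partial j (christoffel G l i k) u
  + \sum_q (christoffel G l i q u * christoffel G q j k u
            - christoffel G l j q u * christoffel G q i k u).

(* R(A, B, C, D) = <R(A, B) D, C>, so that R(A, B, A, B) is the sectional
   curvature of span(A, B) times |A|^2 |B|^2 - <A, B>^2. *)
Definition riemann (R : realType) (m : nat) (G : 'rV[R]_m -> 'M[R]_m)
    (u A B C D : 'rV[R]_m) : R :=
  \sum_i \sum_j \sum_k \sum_l \sum_q
    G u l q * curv_coef G l i j k u * A 0 i * B 0 j * D 0 k * C 0 q.

(* The tangent bundle TM is M x R^n, with coordinates row_mx u v. *)
Definition sasaki (R : realType) (n : nat) (Psi : 'rV[R]_n -> R)
    (p : 'rV[R]_(n + n)) : 'M[R]_(n + n) :=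
  block_mx (hess Psi (lsubmx p)) 0 0 (hess Psi (lsubmx p)).

Definition sasaki_J (R : realType) (n : nat) (w : 'rV[R]_(n + n)) :
    'rV[R]_(n + n) :=
  row_mx (- rsubmx w) (lsubmx w).

Definition extend (R : realType) (n : nat) (xi : 'rV[R]_n) : 'rV[R]_(n + n) :=
  row_mx xi 0.

Definition sharp (R : realType) (n : nat) (Psi : 'rV[R]_n -> R)
    (u : 'rV[R]_n) (eta : 'cV[R]_n) : 'rV[R]_n :=
  (invmx (hess Psi u) *m eta)^T.

(* Main.v *)
Require Import Defs.
From mathcomp Require Import all_boot all_order all_algebra.
From mathcomp Require Import all_classical all_reals all_analysis.
From mathcomp Require Import ring.

Set Implicit Arguments.
Unset Strict Implicit.
Unset Printing Implicit Defensive.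

Import Order.TTheory GRing.Theory Num.Theory.
Import numFieldNormedType.Exports.

Local Open Scope classical_set_scope.
Local Open Scope ring_scope.

(** Put u := x - y and h := eta^sharp, and let H be the Hessian of Psi at u.
    Both sides of the formula are polynomials in the components of xi and h
    whose coefficients come from the fourth derivatives F_ijkl of Psi and from
    the contraction
      Q_ijkl = sum over a, b of Psi_ija H^ab Psi_bkl
    of two third derivatives, all taken at u; the theorem is the comparison of
    these coefficients.

    Since c depends on x - y only, each x-derivative of c is the same
    derivative of Psi and each y-derivative is its opposite.  The signs cancel
    in pairs, and raising eta with the inverse of c_i,j gives - h, so the MTW
    tensor is (Q_ijrs - F_ijrs) xi^i xi^j h^r h^s ([psi_cost_MTW]).

    On the curvature side, lowering the last index of the curvature removes the
    derivative of the inverse metric, because the Levi-Civita connection is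
    metric ([lower_curv]); what remains are first derivatives of the
    Christoffel symbols of the first kind and a quadratic term.  For the Sasaki
    metric the matrix is block diagonal with both blocks H, and depends on the
    base point only.  So the first-kind symbols are 0 or, up to sign, half a
    third derivative of Psi, and this gives
      R(a, b, c, d) = -1/4 (Q_iqjk - Q_jqik) a^i b^j d^k c^q
    for horizontal vectors ([lowered_curv_horizontal]) and
      R(a, Jb, c, Jd) = (-1/2 F_iqjk + 1/4 (Q_iqjk + Q_jqik)) a^i b^j d^k c^q
    for two horizontal and two vertical ones ([lowered_curv_mixed]).  In
    2 R(xi, Jh, xi, Jh) - 2 R(h, xi, h, xi) the terms Q_jqik cancel, because Q
    is invariant under exchanging its two pairs of indices, and Q_iqjk - F_iqjk
    remains ([cross_curvature_identity]).  Coefficients are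
    compared, so the formula holds for all pairs xi, eta, and the statements on
    the MTW tensor and on the cross-curvature follow together.

    All of this uses that the third and fourth derivatives of Psi are
    symmetric.  Regularity is phrased through continuous iterated partial
    derivatives, so the symmetry rests on the theorem of Schwarz
    ([derive_comm]), obtained from two applications of the mean value
    theorem. *)

(** * Symmetry of second derivatives *)

Lemma is_derive_along (R : realType) (V : normedModType R) (f : V -> R)
    (p v : V) (t : R) :
  derivable f (p + t *: v) v ->
  is_derive t 1 (fun s => f (p + s *: v)) ('D_v f (p + t *: v)).
Proof.
have E : (fun h : R => h^-1 *: (((fun s => f (p + s *: v)) \o shift t) (h *: 1)
            - f (p + t *: v))) =
         (fun h => h^-1 *: ((f \o shift (p + t *: v)) (h *: v)
            - f (p + t *: v))).
  apply/funext => h /=; congr (_ *: (f _ - _)).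
  by rewrite [h *: 1]mulr1 scalerDl addrCA.
by move=> df; split; rewrite /derivable /derive E.
Qed.

Lemma MVT_along (R : realType) (V : normedModType R) (f : V -> R)
    (p v : V) (h : R) : 0 < h ->
  (forall t, t \in `[0, h]%R -> derivable f (p + t *: v) v) ->
  exists2 t, t \in `[0, h]%R &
    f (p + h *: v) - f p = 'D_v f (p + t *: v) * h.
Proof.
move=> h0 df; have sub t : t \in `]0, h[%R -> t \in `[0, h]%R.
  exact: subset_itv_oo_cc.
have [||t th] := @MVT R (fun s => f (p + s *: v))
    (fun s => 'D_v f (p + s *: v)) 0 h h0.
- by move=> t /sub th; apply: is_derive_along; exact: df.
- apply: derivable_within_continuous => t th.
  by have /is_derive_along[] := df _ th.
by rewrite scale0r addr0 subr0 => E; exists t => //; exact: sub.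
Qed.

(** The second difference of f over a small parallelogram is an increment of
    p |-> f (p + h w) - f p along v, so the mean value theorem along v turns it
    into an increment of the derivative of f along v, and a second use along w
    turns that into a second derivative at some point of the parallelogram. *)
Lemma second_difference (R : realType) (V : normedModType R) (f : V -> R)
    (u v w : V) (h : R) : 0 < h ->
  (forall s t, s \in `[0, h]%R -> t \in `[0, h]%R ->
     derivable f (u + t *: w + s *: v) v /\
     derivable ('D_v f) (u + s *: v + t *: w) w) ->
  exists s t, [/\ s \in `[0, h]%R, t \in `[0, h]%R &
    f (u + h *: w + h *: v) - f (u + h *: v) - (f (u + h *: w) - f u) =
    'D_w ('D_v f) (u + s *: v + t *: w) * h * h].
Proof.
move=> h0 df.
have h00 : 0 \in `[0, h]%R by rewrite in_itv /= lexx ltW.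
have hh : h \in `[0, h]%R by rewrite in_itv /= lexx ltW.
pose F p := f (p + h *: w) - f p.
(* The difference quotients of a translate are those of f at the translated
   point. *)
have dshift s : s \in `[0, h]%R ->
    is_derive (u + s *: v) v (f \o shift (h *: w))
      ('D_v f (u + s *: v + h *: w)).
  move=> sh; have [d1 _] := df _ _ sh hh.
  rewrite addrAC in d1.
  have E1 : (fun k : R => k^-1 *: (((f \o shift (h *: w))
        \o shift (u + s *: v)) (k *: v)
        - (f \o shift (h *: w)) (u + s *: v))) =
      (fun k => k^-1 *: ((f \o shift (u + s *: v + h *: w)) (k *: v)
        - f (u + s *: v + h *: w))).
    by apply/funext => k /=; rewrite -!addrA.
  by split; rewrite /derivable /derive E1.
have dF s : s \in `[0, h]%R ->
    is_derive (u + s *: v) v F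
      ('D_v f (u + s *: v + h *: w) - 'D_v f (u + s *: v)).
  move=> sh; have [d2 _] := df _ _ sh h00.
  rewrite scale0r addr0 in d2.
  by have := is_deriveB (dshift _ sh) (derivableP d2).
have [s sh Es] := @MVT_along R V F u v h h0
  (fun s sh => @ex_derive _ _ _ _ _ _ _ (dF s sh)).
have [t th Et] := @MVT_along R V ('D_v f) (u + s *: v) w h h0
  (fun t th => (df s t sh th).2).
exists s, t; split => //.
rewrite -Et; rewrite (derive_val (is_derive := dF _ sh)) in Es.
by rewrite -Es /F [u + _ + _]addrAC; ring.
Qed.

(** Theorem of Schwarz.  The second difference is symmetric in v and w, so by
    [second_difference] the two iterated derivatives agree at two points that
    may differ but both lie in any prescribed ball around u; continuity at u
    carries the equality to u. *)
Lemma derive_comm (R : realType) (V : normedModType R) (f : V -> R)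
    (u v w : V) :
  (\forall p \near u, derivable f p v /\ derivable f p w) ->
  (\forall p \near u, derivable ('D_v f) p w /\ derivable ('D_w f) p v) ->
  {for u, continuous ('D_w ('D_v f))} -> {for u, continuous ('D_v ('D_w f))} ->
  'D_w ('D_v f) u = 'D_v ('D_w f) u.
Proof.
move=> d1 d2 c1 c2; apply/eqP; apply: contraT => neq.
set a := 'D_w ('D_v f) u in neq *; set b := 'D_v ('D_w f) u in neq *.
have e0 : 0 < `|a - b| / 2 by rewrite divr_gt0 // normr_gt0 subr_eq0.
have close (g : V -> R) : {for u, continuous g} ->
    \forall p \near u, `|g u - g p| < `|a - b| / 2.
  by move=> /cvgrPdist_lt /(_ _ e0).
have n1 : \forall p \near u, `|a - 'D_w ('D_v f) p| < `|a - b| / 2 :=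
  close _ c1.
have n2 : \forall p \near u, `|b - 'D_v ('D_w f) p| < `|a - b| / 2 :=
  close _ c2.
(* With their bodies visible, the rewriting steps below would try to unify the
   two limits a and b. *)
clearbody a b.
have [r /= r0 sub] :=
  (nbhs_ballP _ _).1 (filterI (filterI d1 d2) (filterI n1 n2)).
(* The summand 1 keeps the denominator of h positive when v = w = 0. *)
have k0 : 0 < `|v| + `|w| + 1 by rewrite ltr_wpDl ?addr_ge0.
pose h := r / (`|v| + `|w| + 1).
have h0 : 0 < h by rewrite divr_gt0.
have inb s t : s \in `[0, h]%R -> t \in `[0, h]%R ->
    ball u r (u + s *: v + t *: w).
  rewrite !in_itv /= => /andP[s0 sh] /andP[t0 th].
  rewrite -ball_normE /= -addrA opprD addrA subrr sub0r normrN.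
  apply: (le_lt_trans (ler_normD _ _)); rewrite !normrZ !ger0_norm //.
  apply: (@le_lt_trans _ _ (h * `|v| + h * `|w|)).
    by rewrite lerD // ler_wpM2r.
  by rewrite -mulrDr /h -mulrAC ltr_pdivrMr // ltr_pM2l // ltrDl.
have {}sub s t sh th := sub _ (inb s t sh th).
have [|s [t [sh th E1]]] := @second_difference R V f u v w h h0.
  move=> s t sh th; split.
    by rewrite addrAC; have [[[]]] := sub _ _ sh th.
  by have [[_ []]] := sub _ _ sh th.
have [|s' [t' [sh' th' E2]]] := @second_difference R V f u w v h h0.
  move=> t' s' th' sh'; rewrite [u + _ + _ in X in _ /\ X]addrAC; split.
    by have [[[]]] := sub _ _ sh' th'.
  by have [[_ []]] := sub _ _ sh' th'.
rewrite [u + _ + _]addrAC in E2.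
have cancel (P Q : R) : P * h * h = Q * h * h -> P = Q.
  have hn0 : h != 0 by rewrite gt_eqF.
  by move=> /(mulIf hn0) /(mulIf hn0).
have swap (a1 a2 a3 a4 : R) : a1 - a2 - (a3 - a4) = a1 - a3 - (a2 - a4).
  by ring.
rewrite swap in E2.
have E := cancel _ _ (etrans (esym E1) E2).
have [_ [A _]] := sub _ _ sh th.
have [_ [_ B]] := sub _ _ th' sh'.
rewrite E in A; rewrite [u + t' *: v + _]addrAC distrC in B.
have := ltrD A B; rewrite -splitr.
by move/(le_lt_trans (ler_distD _ _ _)); rewrite ltxx.
Qed.

Lemma eq_on_open_partial (R : realType) (n : nat) (M : set 'rV[R]_n)
    (f g : 'rV[R]_n -> R) (i : 'I_n) :
  open M -> {in M, f =1 g} -> {in M, partial i f =1 partial i g}.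
Proof.
move=> oM fg u; rewrite inE => Mu; apply: near_eq_derive.
have := open_nbhs_nbhs (conj oM Mu).
by apply: filterS => w Mw; apply: fg; rewrite inE.
Qed.

Lemma is_Ck_partial (R : realType) (n k : nat) (M : set 'rV[R]_n)
    (f : 'rV[R]_n -> R) (i : 'I_n) :
  is_Ck k.+1 M f -> is_Ck k M (partial i f).
Proof. by move=> [_ /(_ i) []]. Qed.

Lemma is_Ck_derivable (R : realType) (n k : nat) (M : set 'rV[R]_n)
    (f : 'rV[R]_n -> R) (i : 'I_n) (u : 'rV[R]_n) :
  is_Ck k.+1 M f -> M u -> derivable f u (delta_mx 0 i).
Proof. by move=> [_ /(_ i) [+ _]]; apply. Qed.

Lemma is_Ck_continuous (R : realType) (n k : nat) (M : set 'rV[R]_n)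
    (f : 'rV[R]_n -> R) (u : 'rV[R]_n) :
  is_Ck k M f -> M u -> {for u, continuous f}.
Proof. by case: k => [|k] [+ _]; apply. Qed.

Lemma partial_comm (R : realType) (n k : nat) (M : set 'rV[R]_n)
    (f : 'rV[R]_n -> R) (i j : 'I_n) :
  open M -> is_Ck k.+2 M f ->
  {in M, partial i (partial j f) =1 partial j (partial i f)}.
Proof.
move=> oM Cf u; rewrite inE => Mu.
have nM := open_nbhs_nbhs (conj oM Mu).
apply: derive_comm.
- by apply: filterS nM => w Mw; split; apply: is_Ck_derivable Cf Mw.
- apply: filterS nM => w Mw.
  split.
    exact: (is_Ck_derivable (is_Ck_partial j Cf) Mw).
  exact: (is_Ck_derivable (is_Ck_partial i Cf) Mw).
- exact: (is_Ck_continuous (is_Ck_partial i (is_Ck_partial j Cf)) Mu).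
- exact: (is_Ck_continuous (is_Ck_partial j (is_Ck_partial i Cf)) Mu).
Qed.

Lemma partialN (R : realType) (n k : nat) (M : set 'rV[R]_n)
    (f : 'rV[R]_n -> R) (i : 'I_n) (u : 'rV[R]_n) :
  is_Ck k.+1 M f -> M u -> partial i (fun w => - f w) u = - partial i f u.
Proof. by move=> Cf Mu; apply: deriveN; exact: is_Ck_derivable Cf Mu. Qed.

(** * Derivatives of a cost that depends on x - y *)

(** In one variable this is the chain rule for s |-> - s; the general case
    follows by restricting f to the line through x - y directed by v. *)
Lemma derive_reflect (R : realType) (V : normedModType R) (f : V -> R)
    (x y v : V) :
  derivable f (x - y) v ->
  'D_v (fun z => f (x - z)) y = - 'D_v f (x - y).
Proof.
move=> df.
pose F (s : R) := f (x - y + s *: v).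
have dF : is_derive (- 0 : R) (1 : R) F ('D_v f (x - y)).
  have := @is_derive_along R V f (x - y) v (- 0).
  by rewrite oppr0 scale0r addr0; apply.
have := is_derive1_comp dF (is_deriveNid (0 : R) 1).
rewrite mulrN1 => -[_ <-]; rewrite /derive.
set g1 := fun h => h^-1 *: _; set g2 := fun h => h^-1 *: _.
suff -> : g1 = g2 by [].
apply/funext => h; rewrite /g1 /g2 /= /F addr0 oppr0 scale0r addr0.
by rewrite [h *: 1]mulr1 opprD scaleNr addrA addrAC.
Qed.

Definition function_of_difference (R : realType) (n : nat)
    (X Y : set 'rV[R]_n) (c : 'rV[R]_n -> 'rV[R]_n -> R)
    (f : 'rV[R]_n -> R) : Prop :=
  forall x y, X x -> Y y -> c x y = f (x - y).

Section FunctionOfDifference.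
Variables (R : realType) (n : nat) (X Y M : set 'rV[R]_n).
Hypothesis subM : forall x y, X x -> Y y -> M (x - y).
Implicit Types (c : 'rV[R]_n -> 'rV[R]_n -> R) (f : 'rV[R]_n -> R) (i : 'I_n).

Lemma function_of_difference_dx c f i : open X ->
  function_of_difference X Y c f ->
  function_of_difference X Y (dx i c) (partial i f).
Proof.
move=> oX cE x y Xx Yy; rewrite /dx /partial.
have -> : 'D_(delta_mx 0 i) (fun x' => c x' y) x
        = 'D_(delta_mx 0 i) (fun x' => f (x' - y)) x.
  apply: near_eq_derive; have := open_nbhs_nbhs (conj oX Xx).
  by apply: filterS => w Xw; exact: cE.
rewrite /derive.
set g1 := fun h => h^-1 *: _; set g2 := fun h => h^-1 *: _.
suff -> : g1 = g2 by [].
by apply/funext => h; rewrite /g1 /g2 /= addrA.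
Qed.

Lemma function_of_difference_dy c f i : open Y ->
  (forall u, M u -> derivable f u (delta_mx 0 i)) ->
  function_of_difference X Y c f ->
  function_of_difference X Y (dy i c) (fun u => - partial i f u).
Proof.
move=> oY df cE x y Xx Yy; rewrite /dy /partial.
rewrite -derive_reflect; last by apply: df; exact: subM.
apply: near_eq_derive; have := open_nbhs_nbhs (conj oY Yy).
by apply: filterS => w Yw; exact: cE.
Qed.

(** Every use of [function_of_difference_dy] leaves a sign inside the function
    that is differentiated next; this brings it back to the front. *)
Lemma function_of_differenceN c f i k : is_Ck k.+1 M f ->
  function_of_difference X Y c (partial i (fun u => - f u)) ->
  function_of_difference X Y c (fun u => - partial i f u).
Proof.
by move=> Cf cE x y Xx Yy; rewrite cE // (partialN _ Cf) //; exact: subM.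
Qed.

Lemma function_of_difference_dydy c f k r s : open Y -> is_Ck k.+2 M f ->
  function_of_difference X Y c f ->
  function_of_difference X Y (dy r (dy s c)) (partial r (partial s f)).
Proof.
move=> oY Cf cE x y Xx Yy; have Cs := is_Ck_partial s Cf.
have csE : function_of_difference X Y (dy s c) (fun u => - partial s f u).
  by apply: function_of_difference_dy oY _ cE => u; exact: is_Ck_derivable Cf.
have dN u : M u -> derivable (fun w => - partial s f w) u (delta_mx 0 r).
  by move=> Mu; apply: derivableN; exact: is_Ck_derivable Cs Mu.
rewrite (function_of_difference_dy oY dN csE) //.
by rewrite (partialN _ Cs) ?opprK //; exact: subM.
Qed.

End FunctionOfDifference.

(** * Differentiability of the inverse of a matrix field *)

Lemma derivable_bigsum (R : realType) (V : normedModType R) (I : Type)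
    (r : seq I) (P : pred I) (F : I -> V -> R) (x v : V) :
  (forall i, derivable (F i) x v) ->
  derivable (fun p => \sum_(i <- r | P i) F i p) x v.
Proof.
move=> dF; elim: r => [|i r IH].
  rewrite (_ : (fun p => _) = cst 0); first exact: derivable_cst.
  by apply/funext => p; rewrite big_nil.
have [Pi|nPi] := boolP (P i); last first.
  rewrite (_ : (fun p => _) = (fun p => \sum_(i <- r | P i) F i p)) //.
  by apply/funext => p; rewrite big_cons (negbTE nPi).
rewrite (_ : (fun p => _) = F i + (fun p => \sum_(i <- r | P i) F i p)).
  exact: derivableD.
by apply/funext => p; rewrite big_cons Pi.
Qed.

Lemma derivable_bigprod (R : realType) (V : normedModType R) (I : Type)
    (r : seq I) (P : pred I) (F : I -> V -> R) (x v : V) :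
  (forall i, derivable (F i) x v) ->
  derivable (fun p => \prod_(i <- r | P i) F i p) x v.
Proof.
move=> dF; elim: r => [|i r IH].
  rewrite (_ : (fun p => _) = cst 1); first exact: derivable_cst.
  by apply/funext => p; rewrite big_nil.
have [Pi|nPi] := boolP (P i); last first.
  rewrite (_ : (fun p => _) = (fun p => \prod_(i <- r | P i) F i p)) //.
  by apply/funext => p; rewrite big_cons (negbTE nPi).
rewrite (_ : (fun p => _) = F i * (fun p => \prod_(i <- r | P i) F i p)).
  exact: derivableM.
by apply/funext => p; rewrite big_cons Pi.
Qed.

Lemma derivable_det (R : realType) (V : normedModType R) (m : nat)
    (A : V -> 'M[R]_m) (x v : V) :
  (forall i j, derivable (fun p => A p i j) x v) ->
  derivable (fun p => \det (A p)) x v.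
Proof.
move=> dA; apply: derivable_bigsum => s.
apply: derivableM; first exact: derivable_cst.
exact: derivable_bigprod.
Qed.

(** By the formula of Cramer, the entries of the inverse are quotients of
    polynomials in the entries of the matrix. *)
Lemma derivable_invmx (R : realType) (V : normedModType R) (m : nat)
    (A : V -> 'M[R]_m) (x v : V) :
  (\forall p \near x, A p \in unitmx) ->
  (forall i j, derivable (fun p => A p i j) x v) ->
  forall i j, derivable (fun p => invmx (A p) i j) x v.
Proof.
move=> uA dA i j.
apply: (@near_eq_derivable _ _ _
  (fun p => (\det (A p))^-1 * ((-1) ^+ (j + i) *
     \det (row' j (col' i (A p)))))).
  apply: filterS uA => p up.
  by rewrite /invmx up !mxE.
have detA : \det (A x) != 0.
  by have := nbhs_singleton uA; rewrite unitmxE unitfE.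
apply: derivableM; first by apply: derivableV => //; exact: derivable_det.
apply: derivableM; first exact: derivable_cst.
apply: derivable_det => k l.
have -> : (fun p => row' j (col' i (A p)) k l)
        = (fun p => A p (lift j k) (lift i l)).
  by apply/funext => p; rewrite !mxE.
exact: dA.
Qed.

(** * The curvature tensor with its last index lowered *)

(** The Christoffel symbols of the first kind, with the lowered index first. *)
Definition christoffel_first (R : realType) (m : nat) (G : 'rV[R]_m -> 'M[R]_m)
    (q j k : 'I_m) (u : 'rV[R]_m) : R :=
  2^-1 * (partial j (fun w => G w k q) u + partial k (fun w => G w j q) u
          - partial q (fun w => G w j k) u).

(** The classical expression of the fully covariant curvature tensor, in which
    only the metric is differentiated and not its inverse;
    [lower_curv] identifies it. *)
Definition lowered_curv (R : realType) (m : nat) (G : 'rV[R]_m -> 'M[R]_m)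
    (q i j k : 'I_m) (u : 'rV[R]_m) : R :=
  partial i (christoffel_first G q j k) u
  - partial j (christoffel_first G q i k) u
  - \sum_l (christoffel_first G l i q u * christoffel G l j k u
            - christoffel_first G l j q u * christoffel G l i k u).

Lemma christoffelE (R : realType) (m : nat) (G : 'rV[R]_m -> 'M[R]_m)
    (k i j : 'I_m) (u : 'rV[R]_m) :
  christoffel G k i j u = \sum_l invmx (G u) k l * christoffel_first G l i j u.
Proof.
by rewrite /christoffel mulr_sumr; apply: eq_bigr => l _; rewrite mulrCA.
Qed.

Lemma lower_christoffel (R : realType) (m : nat) (G : 'rV[R]_m -> 'M[R]_m)
    (q j k : 'I_m) (u : 'rV[R]_m) : G u \in unitmx ->
  \sum_l G u q l * christoffel G l j k u = christoffel_first G q j k u.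
Proof.
move=> uG.
have E : (G u *m (invmx (G u) *m \col_l christoffel_first G l j k u)) q 0
    = christoffel_first G q j k u by rewrite mulKVmx // mxE.
rewrite -E mxE; apply: eq_bigr => l _; rewrite christoffelE mxE.
by congr (_ * _); apply: eq_bigr => a _; rewrite mxE.
Qed.

(** The Levi-Civita connection is metric.  The last two terms of one symbol are
    the opposites of those of the other, and by symmetry of G the first terms
    are equal. *)
Lemma metric_compatibility (R : realType) (m : nat)
    (G : 'rV[R]_m -> 'M[R]_m) (i q l : 'I_m) (u : 'rV[R]_m) :
  (forall a b,
     partial i (fun w => G w a b) u = partial i (fun w => G w b a) u) ->
  partial i (fun w => G w q l) u
    = christoffel_first G l i q u + christoffel_first G q i l u.
Proof. by move=> sG; rewrite /christoffel_first (sG l q); field. Qed.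

Section LoweredCurvature.
Variables (R : realType) (m : nat) (G : 'rV[R]_m -> 'M[R]_m) (u : 'rV[R]_m).
Hypothesis unitG : \forall p \near u, G p \in unitmx.
Hypothesis symG : \forall p \near u, forall i j, G p i j = G p j i.
Hypothesis dG : forall i j k, derivable (fun p => G p i j) u (delta_mx 0 k).
Hypothesis ddG : forall i j k l,
  derivable (partial l (fun p => G p i j)) u (delta_mx 0 k).

Lemma derivable_christoffel_first q j k i :
  derivable (christoffel_first G q j k) u (delta_mx 0 i).
Proof.
apply: derivableM; first exact: derivable_cst.
by apply: derivableB; first apply: derivableD; exact: ddG.
Qed.

Lemma derivable_christoffel l j k i :
  derivable (christoffel G l j k) u (delta_mx 0 i).
Proof.
rewrite (_ : christoffel G l j k =
  fun p => \sum_q invmx (G p) l q * christoffel_first G q j k p); last first.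
  by apply/funext => p; rewrite christoffelE.
apply: derivable_bigsum => q; apply: derivableM.
  by apply: derivable_invmx.
exact: derivable_christoffel_first.
Qed.

(** Differentiating the identity of [lower_christoffel], which holds near u, by
    the product rule; the derivative of the metric that appears is rewritten
    with [metric_compatibility]. *)
Lemma lower_partial_christoffel q i j k :
  \sum_l G u q l * partial i (christoffel G l j k) u
  = partial i (christoffel_first G q j k) u
    - \sum_l (christoffel_first G l i q u + christoffel_first G q i l u)
             * christoffel G l j k u.
Proof.
have dGam l := @derivable_christoffel l j k i.
have <- : partial i (fun p => \sum_l G p q l * christoffel G l j k p) u
       = partial i (christoffel_first G q j k) u.
  apply: near_eq_derive; apply: filterS unitG => p up.
  exact: lower_christoffel.
have -> : (fun p => \sum_l G p q l * christoffel G l j k p)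
        = \sum_l ((fun p => G p q l) * christoffel G l j k).
  by apply/funext => p; rewrite fct_sumE.
rewrite /partial derive_sum => [|l]; last exact: derivableM.
rewrite -sumrB; apply: eq_bigr => l _.
rewrite (deriveM (@dG q l i) (dGam l)) -metric_compatibility; last first.
  by move=> a b; apply: near_eq_derive; apply: filterS symG => p ->.
have cancel (a b c d : R) : a * b = a *: b + c *: d - d * c.
  by rewrite [c *: d]mulrC addrK.
exact: cancel.
Qed.

(** Lowering the quadratic part of the curvature produces one of the two
    halves of the derivative of the metric found in
    [lower_partial_christoffel] with the opposite sign, so that only the other
    half is left in [lowered_curv]. *)
Lemma lower_curv q i j k :
  \sum_l G u q l * curv_coef G l i j k u = lowered_curv G q i j k u.
Proof.
have unitu := nbhs_singleton unitG.
have prod i' j' : \sum_l G u q l *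
      \sum_p christoffel G l i' p u * christoffel G p j' k u
    = \sum_p christoffel_first G q i' p u * christoffel G p j' k u.
  under eq_bigr do rewrite mulr_sumr.
  rewrite exchange_big /=; apply: eq_bigr => p _.
  rewrite -(lower_christoffel _ _ _ unitu) mulr_suml.
  by apply: eq_bigr => l _; rewrite mulrA.
have expand (g a b c d : 'I_m -> R) :
    \sum_l g l * (a l - b l + (c l - d l)) =
    \sum_l g l * a l - \sum_l g l * b l
    + (\sum_l g l * c l - \sum_l g l * d l).
  by rewrite -!sumrB -big_split; apply: eq_bigr => l _; rewrite mulrDr !mulrBr.
transitivity (\sum_l G u q l *
    (partial i (christoffel G l j k) u - partial j (christoffel G l i k) u
     + (\sum_p christoffel G l i p u * christoffel G p j k u
        - \sum_p christoffel G l j p u * christoffel G p i k u))).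
  by apply: eq_bigr => l _; rewrite -sumrB.
apply: etrans (expand _ _ _ _ _) _.
have lower4 a1 a2 a3 a4 b1 b2 b3 b4 : a1 = b1 -> a2 = b2 -> a3 = b3 ->
    a4 = b4 -> a1 - a2 + (a3 - a4) = b1 - b2 + (b3 - b4) :> R.
  by move=> -> -> -> ->.
apply: etrans (lower4 _ _ _ _ _ _ _ _ (lower_partial_christoffel q i j k)
  (lower_partial_christoffel q j i k) (prod i j) (prod j i)) _.
rewrite /lowered_curv sumrB.
have split i' j' :
    \sum_l (christoffel_first G l i' q u + christoffel_first G q i' l u)
      * christoffel G l j' k u
    = \sum_l christoffel_first G l i' q u * christoffel G l j' k u
      + \sum_l christoffel_first G q i' l u * christoffel G l j' k u.
  by rewrite -big_split; apply: eq_bigr => l _; rewrite mulrDl.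
by rewrite (split i j) (split j i); ring.
Qed.

Lemma riemannE A B C D :
  riemann G u A B C D =
  \sum_i \sum_j \sum_k \sum_q
    lowered_curv G q i j k u * A 0 i * B 0 j * D 0 k * C 0 q.
Proof.
apply: eq_bigr => i _; apply: eq_bigr => j _; apply: eq_bigr => k _.
rewrite exchange_big; apply: eq_bigr => q _ /=.
rewrite -lower_curv !mulr_suml; apply: eq_bigr => l _.
by rewrite (nbhs_singleton symG).
Qed.

End LoweredCurvature.

(** * Third and fourth derivatives of the potential *)

Definition partial3 (R : realType) (n : nat) (f : 'rV[R]_n -> R)
    (i j k : 'I_n) : 'rV[R]_n -> R :=
  partial i (partial j (partial k f)).

Definition partial4 (R : realType) (n : nat) (f : 'rV[R]_n -> R)
    (i j k l : 'I_n) : 'rV[R]_n -> R :=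
  partial i (partial3 f j k l).

(** The product term of the MTW tensor with the derivatives of the cost replaced
    by those of f; the curvature of the Hessian metric is quadratic in the same
    quantity. *)
Definition contract_partial3 (R : realType) (n : nat) (f : 'rV[R]_n -> R)
    (u : 'rV[R]_n) (i j k l : 'I_n) : R :=
  \sum_a \sum_b partial3 f i j a u * invmx (hess f u) a b * partial3 f b k l u.

Section Symmetries.
Variables (R : realType) (n : nat) (M : set 'rV[R]_n) (f : 'rV[R]_n -> R).
Hypotheses (openM : open M) (Cf : is_Ck 4 M f).
Variables (u : 'rV[R]_n) (Mu : M u).

Let inM : u \in M. Proof. by rewrite inE. Qed.

Lemma hess_sym : (hess f u)^T = hess f u.
Proof.
by apply/matrixP => i j; rewrite !mxE (partial_comm j i openM Cf).
Qed.

Lemma partial3_swap12 i j k : partial3 f i j k u = partial3 f j i k u.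
Proof. exact: (partial_comm i j openM (is_Ck_partial k Cf)). Qed.

Lemma partial3_swap23 i j k : partial3 f i j k u = partial3 f i k j u.
Proof. exact: (eq_on_open_partial i openM (partial_comm j k openM Cf)). Qed.

Lemma partial4_swap12 i j k l : partial4 f i j k l u = partial4 f j i k l u.
Proof.
exact: (partial_comm i j openM (is_Ck_partial k (is_Ck_partial l Cf))).
Qed.

(** Full symmetry of the third derivatives allows the two factors to be
    exchanged, and the inverse Hessian is symmetric. *)
Lemma contract_partial3_swap i j k l :
  contract_partial3 f u i j k l = contract_partial3 f u k l i j.
Proof.
have symH a b : invmx (hess f u) a b = invmx (hess f u) b a.
  by rewrite -{1}hess_sym -trmx_inv mxE.
rewrite /contract_partial3 [LHS]exchange_big /=.
apply: eq_bigr => b _; apply: eq_bigr => a _.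
have -> : partial3 f i j a u = partial3 f a i j u.
  by rewrite partial3_swap23 partial3_swap12.
have -> : partial3 f b k l u = partial3 f k l b u.
  by rewrite partial3_swap12 partial3_swap23.
rewrite symH.
(* Stated for variables, because [ring] would compare the partial derivatives
   with each other by unfolding them to limits. *)
have comm3 (x h y : R) : x * h * y = y * h * x by ring.
exact: comm3.
Qed.

End Symmetries.

Lemma partial4_swap23 (R : realType) (n : nat) (M : set 'rV[R]_n)
    (f : 'rV[R]_n -> R) (u : 'rV[R]_n) i j k l :
  open M -> is_Ck 4 M f -> M u ->
  partial4 f i j k l u = partial4 f i k j l u.
Proof.
move=> oM Cf Mu; apply: (eq_on_open_partial i oM); last by rewrite inE.
by move=> w; rewrite inE => Mw; exact: partial3_swap12 Mw j k l.
Qed.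

(** * Functions on the tangent bundle pulled back from the base *)

Section BaseFunctions.
Variables (R : realType) (n : nat).
Implicit Types (f : 'rV[R]_n -> R) (p w : 'rV[R]_(n + n)).

Let quotient_lsubmx f p w :
  (fun h : R => h^-1 *: (((f \o lsubmx) \o shift p) (h *: w)
                         - (f \o lsubmx) p)) =
  (fun h => h^-1 *: ((f \o shift (lsubmx p)) (h *: lsubmx w)
                     - f (lsubmx p))).
Proof.
apply/funext => h /=; congr (_ *: (f _ - _)).
by apply/matrixP => i j; rewrite !mxE.
Qed.

Lemma derivable_lsubmx f p w :
  derivable f (lsubmx p) (lsubmx w) -> derivable (f \o lsubmx) p w.
Proof. by rewrite /derivable quotient_lsubmx. Qed.

Lemma derive_lsubmx f p w :
  'D_w (f \o lsubmx) p = 'D_(lsubmx w) f (lsubmx p).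
Proof. by rewrite /derive quotient_lsubmx. Qed.

Lemma lsubmx_delta_lshift (i : 'I_n) :
  lsubmx (delta_mx 0 (lshift n i)) = delta_mx 0 i :> 'rV[R]_n.
Proof. by apply/rowP => j; rewrite !mxE eq_lshift. Qed.

Lemma lsubmx_delta_rshift (i : 'I_n) :
  lsubmx (delta_mx 0 (rshift n i)) = 0 :> 'rV[R]_n.
Proof. by apply/rowP => j; rewrite !mxE eq_lrshift. Qed.

Lemma partial_lshift f (i : 'I_n) :
  partial (lshift n i) (f \o lsubmx) = partial i f \o lsubmx.
Proof.
by apply/funext => p; rewrite /partial derive_lsubmx lsubmx_delta_lshift.
Qed.

Lemma partial_rshift f (i : 'I_n) :
  partial (rshift n i) (f \o lsubmx) = cst 0.
Proof.
apply/funext => p.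
by rewrite /partial derive_lsubmx lsubmx_delta_rshift derive0.
Qed.

Lemma partial_cst0 m (i : 'I_m) :
  partial i (cst 0 : 'rV[R]_m -> R) = cst 0.
Proof. by apply/funext => p; exact: derive_cst. Qed.

End BaseFunctions.

Lemma is_Ck_cst0 (R : realType) (n k : nat) (M : set 'rV[R]_n) :
  is_Ck k M (cst 0).
Proof.
elim: k => [|k IH]; (split; first by move=> u _; exact: cst_continuous) => //.
by move=> i; split=> [u _|]; [exact: derivable_cst | rewrite partial_cst0].
Qed.

(** * The curvature of the Sasaki metric *)

(** A nonzero vector in the kernel would be isotropic. *)
Lemma posdefmx_unit (R : realType) (n : nat) (A : 'M[R]_n) :
  posdefmx A -> A \in unitmx.
Proof.
move=> pA; rewrite -row_free_unit -kermx_eq0; apply: contraT.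
move=> /rowV0Pn[v /sub_kermxP vA /pA].
by rewrite vA mul0mx mxE ltxx.
Qed.

Section SasakiCurvature.
Variables (R : realType) (n : nat) (M : set 'rV[R]_n) (Psi : 'rV[R]_n -> R).
Hypotheses (openM : open M) (CPsi : is_Ck 4 M Psi).
Hypothesis posPsi : forall u, M u -> posdefmx (hess Psi u).

Let TM : set 'rV[R]_(n + n) := [set p | M (lsubmx p)].

Let openTM : open TM.
Proof. by apply: open_comp openM => p _; exact: continuous_lsubmx. Qed.

(** In the names below, l stands for a base direction [lshift n i] and r for a
    fibre direction [rshift n i], one letter for each index. *)
Lemma sasaki_ll i j : (fun p => sasaki Psi p (lshift n i) (lshift n j))
  = partial i (partial j Psi) \o lsubmx.
Proof. by apply/funext => p; rewrite /sasaki block_mxEul mxE. Qed.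

Lemma sasaki_rr i j : (fun p => sasaki Psi p (rshift n i) (rshift n j))
  = partial i (partial j Psi) \o lsubmx.
Proof. by apply/funext => p; rewrite /sasaki block_mxEdr mxE. Qed.

Lemma sasaki_lr i j :
  (fun p => sasaki Psi p (lshift n i) (rshift n j)) = cst 0.
Proof. by apply/funext => p; rewrite /sasaki block_mxEur mxE. Qed.

Lemma sasaki_rl i j :
  (fun p => sasaki Psi p (rshift n i) (lshift n j)) = cst 0.
Proof. by apply/funext => p; rewrite /sasaki block_mxEdl mxE. Qed.

(** A uniform description of the four kinds of entries, so that their regularity
    is not proved block by block. *)
Lemma sasaki_pullback i j : exists2 f, is_Ck 2 M f &
  (fun p => sasaki Psi p i j) = f \o lsubmx.
Proof.
case: (split_ordP i) => i' ->; case: (split_ordP j) => j' ->.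
- exists (partial i' (partial j' Psi)); last exact: sasaki_ll.
  exact: is_Ck_partial (is_Ck_partial _ CPsi).
- by exists (cst 0); [exact: is_Ck_cst0 | rewrite sasaki_lr].
- by exists (cst 0); [exact: is_Ck_cst0 | rewrite sasaki_rl].
- exists (partial i' (partial j' Psi)); last exact: sasaki_rr.
  exact: is_Ck_partial (is_Ck_partial _ CPsi).
Qed.

Lemma sasaki_unit p : TM p -> sasaki Psi p \in unitmx.
Proof.
move=> Mp; rewrite /sasaki block_diag_mx_unit.
by rewrite posdefmx_unit //; exact: posPsi.
Qed.

Lemma sasaki_sym p i j : TM p -> sasaki Psi p i j = sasaki Psi p j i.
Proof.
move=> Mp; have tr : (sasaki Psi p)^T = sasaki Psi p.
  by rewrite /sasaki tr_block_mx !trmx0 (hess_sym openM CPsi Mp).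
by rewrite -{1}tr mxE.
Qed.

Lemma near_TM p : TM p -> \forall w \near p, TM w.
Proof. by move=> Mp; exact: open_nbhs_nbhs. Qed.

Lemma derivable_base k f p i : is_Ck k.+1 M f -> TM p ->
  derivable (f \o lsubmx) p (delta_mx 0 i).
Proof.
move=> Cf Mp; apply: derivable_lsubmx.
case: (split_ordP i) => j ->.
  by rewrite lsubmx_delta_lshift; exact: is_Ck_derivable Cf Mp.
by rewrite lsubmx_delta_rshift; exact: derivable0.
Qed.

Lemma derivable_sasaki p i j k : TM p ->
  derivable (fun w => sasaki Psi w i j) p (delta_mx 0 k).
Proof.
move=> Mp; have [f Cf ->] := sasaki_pullback i j.
exact: derivable_base Cf Mp.
Qed.

Lemma derivable_partial_sasaki p i j k l : TM p ->
  derivable (partial l (fun w => sasaki Psi w i j)) p (delta_mx 0 k).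
Proof.
move=> Mp; have [f Cf ->] := sasaki_pullback i j.
case: (split_ordP l) => l' ->.
  by rewrite partial_lshift; exact: derivable_base (is_Ck_partial l' Cf) Mp.
by rewrite partial_rshift; exact: derivable_cst.
Qed.

(** The metric does not depend on the fibre coordinates and does not mix the two
    kinds of directions: a symbol is nonzero only if the number of its fibre
    indices is 0 or 2.  In the first case two of the three equal third
    derivatives cancel; in the second only the derivative along the base index
    is left, with a minus sign when that index is the lowered one. *)
Lemma christoffel_first_lll q j k : {in TM,
  christoffel_first (sasaki Psi) (lshift n q) (lshift n j) (lshift n k)
  =1 2^-1 \*: (partial3 Psi q j k \o lsubmx)}.
Proof.
move=> p; rewrite inE => Mp.
rewrite /christoffel_first !sasaki_ll !partial_lshift /=.
rewrite -!/(partial3 _ _ _ _).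
rewrite (partial3_swap23 openM CPsi Mp j k q)
  (partial3_swap12 openM CPsi Mp j q k).
rewrite (partial3_swap23 openM CPsi Mp k j q)
  (partial3_swap12 openM CPsi Mp k q j).
rewrite (partial3_swap23 openM CPsi Mp q k j).
by rewrite addrK.
Qed.

Lemma christoffel_first_lrr q j k : {in TM,
  christoffel_first (sasaki Psi) (lshift n q) (rshift n j) (rshift n k)
  =1 (- 2^-1) \*: (partial3 Psi q j k \o lsubmx)}.
Proof.
move=> p; rewrite inE => Mp; rewrite /christoffel_first !sasaki_rl sasaki_rr.
rewrite !partial_cst0 partial_lshift /= addr0 sub0r.
by rewrite mulrN -mulNr.
Qed.

Lemma christoffel_first_rlr q j k : {in TM,
  christoffel_first (sasaki Psi) (rshift n q) (lshift n j) (rshift n k)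
  =1 2^-1 \*: (partial3 Psi q j k \o lsubmx)}.
Proof.
move=> p; rewrite inE => Mp; rewrite /christoffel_first sasaki_rr !sasaki_lr.
rewrite partial_lshift !partial_cst0 /= addr0 subr0 -/(partial3 _ _ _ _ _).
rewrite (partial3_swap23 openM CPsi Mp j k q)
  (partial3_swap12 openM CPsi Mp j q k).
by [].
Qed.

Lemma christoffel_first_rrl q j k : {in TM,
  christoffel_first (sasaki Psi) (rshift n q) (rshift n j) (lshift n k)
  =1 2^-1 \*: (partial3 Psi q j k \o lsubmx)}.
Proof.
move=> p; rewrite inE => Mp.
rewrite /christoffel_first sasaki_rr sasaki_lr sasaki_rl.
rewrite partial_lshift !partial_cst0 /= add0r subr0 -/(partial3 _ _ _ _ _).
rewrite (partial3_swap23 openM CPsi Mp k j q)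
  (partial3_swap12 openM CPsi Mp k q j).
by rewrite (partial3_swap23 openM CPsi Mp q k j).
Qed.

Lemma christoffel_first_llr q j k :
  christoffel_first (sasaki Psi) (lshift n q) (lshift n j) (rshift n k) = cst 0.
Proof.
apply/funext => p; rewrite /christoffel_first sasaki_rl sasaki_ll sasaki_lr.
by rewrite !partial_cst0 partial_rshift /= addr0 subr0 mulr0.
Qed.

Lemma christoffel_first_lrl q j k :
  christoffel_first (sasaki Psi) (lshift n q) (rshift n j) (lshift n k) = cst 0.
Proof.
apply/funext => p; rewrite /christoffel_first !sasaki_rl sasaki_ll.
by rewrite !partial_cst0 partial_rshift /= addr0 subr0 mulr0.
Qed.

Lemma christoffel_first_rll q j k :
  christoffel_first (sasaki Psi) (rshift n q) (lshift n j) (lshift n k) = cst 0.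
Proof.
apply/funext => p; rewrite /christoffel_first !sasaki_lr sasaki_ll.
by rewrite !partial_cst0 partial_rshift /= addr0 subr0 mulr0.
Qed.

Lemma partial_scaled_partial3 c i q j k p : TM p ->
  partial (lshift n i) (c \*: (partial3 Psi q j k \o lsubmx)) p
  = c * partial4 Psi i q j k (lsubmx p).
Proof.
move=> Mp; have C3 := is_Ck_partial q (is_Ck_partial j (is_Ck_partial k CPsi)).
have dT : derivable (partial3 Psi q j k \o lsubmx) p (delta_mx 0 (lshift n i)).
  exact: derivable_base C3 Mp.
transitivity (c * partial (lshift n i) (partial3 Psi q j k \o lsubmx) p).
  exact: (deriveZ c dT).
by rewrite partial_lshift.
Qed.

Lemma christoffel_l a j k p : TM p ->
  christoffel (sasaki Psi) (lshift n a) j k p =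
  \sum_b invmx (hess Psi (lsubmx p)) a b
          * christoffel_first (sasaki Psi) (lshift n b) j k p.
Proof.
move=> Mp; rewrite christoffelE invmx_block_diag; last exact: sasaki_unit.
rewrite big_split_ord /= [X in _ + X]big1 ?addr0; last first.
  by move=> b _; rewrite block_mxEur mxE mul0r.
by apply: eq_bigr => b _; rewrite block_mxEul.
Qed.

Lemma christoffel_r a j k p : TM p ->
  christoffel (sasaki Psi) (rshift n a) j k p =
  \sum_b invmx (hess Psi (lsubmx p)) a b
          * christoffel_first (sasaki Psi) (rshift n b) j k p.
Proof.
move=> Mp; rewrite christoffelE invmx_block_diag; last exact: sasaki_unit.
rewrite big_split_ord /= [X in X + _]big1 ?add0r; last first.
  by move=> b _; rewrite block_mxEdl mxE mul0r.
by apply: eq_bigr => b _; rewrite block_mxEdr.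
Qed.

(** The quadratic terms of the curvature have this shape, where c and d are the
    factors 1/2 or - 1/2 of the two Christoffel symbols. *)
Lemma sum_partial3_partial3 c d i q j k u : M u ->
  \sum_a (c * partial3 Psi a i q u) *
    (\sum_b invmx (hess Psi u) a b * (d * partial3 Psi b j k u))
  = c * d * contract_partial3 Psi u i q j k.
Proof.
move=> Mu; rewrite /contract_partial3 mulr_sumr; apply: eq_bigr => a _.
rewrite !mulr_sumr; apply: eq_bigr => b _.
rewrite (partial3_swap12 openM CPsi Mu a i q)
  (partial3_swap23 openM CPsi Mu i a q).
have comm (x h y : R) : c * x * (h * (d * y)) = c * d * (x * h * y) by ring.
exact: comm.
Qed.

(** The fourth derivatives, which enter through the derivatives of the
    Christoffel symbols, cancel by symmetry: the curvature of a Hessian metric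
    involves only third derivatives of the potential. *)
Lemma lowered_curv_horizontal q i j k p : TM p ->
  lowered_curv (sasaki Psi)
    (lshift n q) (lshift n i) (lshift n j) (lshift n k) p
  = - 4^-1 * (contract_partial3 Psi (lsubmx p) i q j k
              - contract_partial3 Psi (lsubmx p) j q i k).
Proof.
move=> Mp; have inTM : p \in TM by rewrite inE.
have quad i' j' :
    \sum_l christoffel_first (sasaki Psi) l (lshift n i') (lshift n q) p
      * christoffel (sasaki Psi) l (lshift n j') (lshift n k) p
    = 4^-1 * contract_partial3 Psi (lsubmx p) i' q j' k.
  rewrite big_split_ord /= [X in _ + X]big1 ?addr0; last first.
    by move=> a _; rewrite christoffel_first_rll mul0r.
  rewrite -[4^-1](_ : 2^-1 * 2^-1 = _); last by field.
  rewrite -sum_partial3_partial3 //; apply: eq_bigr => a _.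
  rewrite christoffel_first_lll // christoffel_l //; congr (_ * _).
  by apply: eq_bigr => b _; rewrite christoffel_first_lll.
rewrite /lowered_curv sumrB !quad.
rewrite (eq_on_open_partial _ openTM (christoffel_first_lll q j k) inTM).
rewrite (eq_on_open_partial _ openTM (christoffel_first_lll q i k) inTM).
rewrite !partial_scaled_partial3 //.
have -> : partial4 Psi i q j k (lsubmx p) = partial4 Psi j q i k (lsubmx p).
  rewrite (partial4_swap23 _ _ _ _ openM CPsi Mp).
  rewrite (partial4_swap12 openM CPsi Mp).
  by rewrite (partial4_swap23 _ _ _ _ openM CPsi Mp).
rewrite subrr sub0r -mulrBr; exact/esym/mulNr.
Qed.

(** Here the fourth derivatives survive, because the metric is constant along
    the fibres and one of the two derivatives of Christoffel symbols is zero.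
    In the two quadratic terms the summation index is a base index and a fibre
    index respectively. *)
Lemma lowered_curv_mixed q i j k p : TM p ->
  lowered_curv (sasaki Psi)
    (lshift n q) (lshift n i) (rshift n j) (rshift n k) p
  = - 2^-1 * partial4 Psi i q j k (lsubmx p)
    + 4^-1 * (contract_partial3 Psi (lsubmx p) i q j k
              + contract_partial3 Psi (lsubmx p) j q i k).
Proof.
move=> Mp; have inTM : p \in TM by rewrite inE.
have half2 : 2^-1 * 2^-1 = 4^-1 :> R by field.
have quad1 : \sum_l christoffel_first (sasaki Psi) l (lshift n i) (lshift n q) p
      * christoffel (sasaki Psi) l (rshift n j) (rshift n k) p
    = - 4^-1 * contract_partial3 Psi (lsubmx p) i q j k.
  rewrite big_split_ord /= [X in _ + X]big1 ?addr0; last first.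
    by move=> a _; rewrite christoffel_first_rll mul0r.
  rewrite -half2 -mulrN -sum_partial3_partial3 //; apply: eq_bigr => a _.
  rewrite christoffel_first_lll // christoffel_l //; congr (_ * _).
  by apply: eq_bigr => b _; rewrite christoffel_first_lrr.
have quad2 : \sum_l christoffel_first (sasaki Psi) l (rshift n j) (lshift n q) p
      * christoffel (sasaki Psi) l (lshift n i) (rshift n k) p
    = 4^-1 * contract_partial3 Psi (lsubmx p) j q i k.
  rewrite big_split_ord /= [X in X + _]big1 ?add0r; last first.
    by move=> a _; rewrite christoffel_first_lrl mul0r.
  rewrite -half2 -sum_partial3_partial3 //; apply: eq_bigr => a _.
  rewrite christoffel_first_rrl // christoffel_r //; congr (_ * _).
  by apply: eq_bigr => b _; rewrite christoffel_first_rlr.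
rewrite /lowered_curv sumrB quad1 quad2.
rewrite (eq_on_open_partial _ openTM (christoffel_first_lrr q j k) inTM).
rewrite christoffel_first_llr partial_cst0 partial_scaled_partial3 //.
have fin (f c d : R) : - 2^-1 * f - 0 - (- 4^-1 * c - 4^-1 * d)
    = - 2^-1 * f + 4^-1 * (c + d) by ring.
exact: fin.
Qed.

Lemma sasaki_riemannE p A B C D : TM p ->
  riemann (sasaki Psi) p A B C D =
  \sum_i \sum_j \sum_k \sum_q
    lowered_curv (sasaki Psi) q i j k p * A 0 i * B 0 j * D 0 k * C 0 q.
Proof.
move=> Mp; apply: riemannE.
- by apply: filterS (near_TM Mp) => w; exact: sasaki_unit.
- by apply: filterS (near_TM Mp) => w Mw i j; exact: sasaki_sym.
- by move=> i j k; exact: derivable_sasaki.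
- by move=> i j k l; exact: derivable_partial_sasaki.
Qed.

Lemma row_mx0r (a : 'rV[R]_n) (i : 'I_n) :
  row_mx a (0 : 'rV[R]_n) 0 (rshift n i) = 0.
Proof. by rewrite row_mxEr mxE. Qed.

Lemma row_mx0l (a : 'rV[R]_n) (i : 'I_n) :
  row_mx (0 : 'rV[R]_n) a 0 (lshift n i) = 0.
Proof. by rewrite row_mxEl mxE. Qed.

Lemma riemann_horizontal p (a b c d : 'rV[R]_n) : TM p ->
  riemann (sasaki Psi) p (row_mx a 0) (row_mx b 0) (row_mx c 0) (row_mx d 0) =
  \sum_i \sum_j \sum_k \sum_q
    lowered_curv (sasaki Psi)
    (lshift n q) (lshift n i) (lshift n j) (lshift n k) p
    * a 0 i * b 0 j * d 0 k * c 0 q.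
Proof.
move=> Mp; rewrite sasaki_riemannE //.
rewrite big_split_ord /= [X in _ + X]big1 ?addr0 => [|i _]; last first.
  by do 3!apply: big1 => ? _; rewrite row_mx0r mulr0 !mul0r.
apply: eq_bigr => i _.
rewrite big_split_ord /= [X in _ + X]big1 ?addr0 => [|j _]; last first.
  by do 2!apply: big1 => ? _; rewrite row_mx0r mulr0 !mul0r.
apply: eq_bigr => j _.
rewrite big_split_ord /= [X in _ + X]big1 ?addr0 => [|k _]; last first.
  by apply: big1 => ? _; rewrite row_mx0r mulr0 mul0r.
apply: eq_bigr => k _.
rewrite big_split_ord /= [X in _ + X]big1 ?addr0 => [|q _]; last first.
  by rewrite row_mx0r mulr0.
by apply: eq_bigr => q _; rewrite !row_mxEl.
Qed.

Lemma riemann_mixed p (a b c d : 'rV[R]_n) : TM p ->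
  riemann (sasaki Psi) p (row_mx a 0) (row_mx 0 b) (row_mx c 0) (row_mx 0 d) =
  \sum_i \sum_j \sum_k \sum_q
    lowered_curv (sasaki Psi)
    (lshift n q) (lshift n i) (rshift n j) (rshift n k) p
    * a 0 i * b 0 j * d 0 k * c 0 q.
Proof.
move=> Mp; rewrite sasaki_riemannE //.
rewrite big_split_ord /= [X in _ + X]big1 ?addr0 => [|i _]; last first.
  by do 3!apply: big1 => ? _; rewrite row_mx0r mulr0 !mul0r.
apply: eq_bigr => i _.
rewrite big_split_ord /= [X in X + _]big1 ?add0r => [|j _]; last first.
  by do 2!apply: big1 => ? _; rewrite row_mx0l mulr0 !mul0r.
apply: eq_bigr => j _.
rewrite big_split_ord /= [X in X + _]big1 ?add0r => [|k _]; last first.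
  by apply: big1 => ? _; rewrite row_mx0l mulr0 mul0r.
apply: eq_bigr => k _.
rewrite big_split_ord /= [X in _ + X]big1 ?addr0 => [|q _]; last first.
  by rewrite row_mx0r mulr0.
by apply: eq_bigr => q _; rewrite !row_mxEl !row_mxEr.
Qed.

End SasakiCurvature.

(** * Comparison of the two sides *)

Lemma exchange_big_pairs (R : realType) (n : nat)
    (F : 'I_n -> 'I_n -> 'I_n -> 'I_n -> R) :
  \sum_k \sum_l \sum_r \sum_s F k l r s = \sum_r \sum_s \sum_k \sum_l F k l r s.
Proof.
transitivity (\sum_k \sum_r \sum_l \sum_s F k l r s).
  by apply: eq_bigr => k _; exact: exchange_big.
rewrite exchange_big; apply: eq_bigr => r _.
transitivity (\sum_k \sum_s \sum_l F k l r s).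
  by apply: eq_bigr => k _; exact: exchange_big.
exact: exchange_big.
Qed.

Lemma sum_raise (R : realType) (n : nat) (W : 'I_n -> 'I_n -> R)
    (K : 'M[R]_n) (eta : 'cV[R]_n) (a b : R) :
  \sum_k \sum_l \sum_r \sum_s
     W r s * K r k * K s l * a * b * eta k 0 * eta l 0
  = \sum_r \sum_s
     W r s * a * b * (K *m eta)^T 0 r * (K *m eta)^T 0 s.
Proof.
rewrite exchange_big_pairs; apply: eq_bigr => r _; apply: eq_bigr => s _.
rewrite !mxE -mulrA big_distrlr /= mulr_sumr; apply: eq_bigr => k _.
by rewrite mulr_sumr; apply: eq_bigr => l _; ring.
Qed.

(** The matrix c_i,j is - H, so each index raised with its inverse contributes a
    sign; the two signs of the raised covectors cancel each other, and so do
    that of the inner inverse and that of the third derivative taken once in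
    y. *)
Lemma psi_cost_MTW (R : realType) (n : nat) (X Y M : set 'rV[R]_n)
    (Psi : 'rV[R]_n -> R) (c : 'rV[R]_n -> 'rV[R]_n -> R)
    (x y xi : 'rV[R]_n) (eta : 'cV[R]_n) :
  open X -> open Y -> is_Psi_cost X Y M Psi c -> X x -> Y y ->
  let h := sharp Psi (x - y) eta in
  MTW c x y xi eta =
  \sum_i \sum_j \sum_r \sum_s
    (contract_partial3 Psi (x - y) i j r s - partial4 Psi i j r s (x - y))
    * xi 0 i * xi 0 j * h 0 r * h 0 s.
Proof.
move=> oX oY [oM subM _ CPsi pos cE] Xx Yy h.
have {}subM a b : X a -> Y b -> M (a - b).
  by move=> Xa Yb; apply: subM; exists a => //; exists b.
have Mxy := subM _ _ Xx Yy.
have CN j : function_of_difference X Y (dy j c) (fun u => - partial j Psi u).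
  apply: (function_of_difference_dy subM oY) cE => u.
  exact: is_Ck_derivable CPsi.
have CN2 i j : function_of_difference X Y (dx i (dy j c))
    (fun u => - partial i (partial j Psi) u).
  apply: (function_of_differenceN subM (is_Ck_partial j CPsi)).
  exact: function_of_difference_dx oX (CN j).
have CN3 i j k : function_of_difference X Y (dx i (dx j (dy k c)))
    (fun u => - partial3 Psi i j k u).
  apply: (function_of_differenceN subM
            (is_Ck_partial j (is_Ck_partial k CPsi))).
  exact: function_of_difference_dx oX (CN2 j k).
have D3 q r s : function_of_difference X Y (dx q (dy r (dy s c)))
    (partial3 Psi q r s).
  apply: (function_of_difference_dx _ oX).
  exact: (function_of_difference_dydy subM r s oY CPsi cE).
have D4 i j r s : function_of_difference X Y (dx i (dx j (dy r (dy s c))))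
    (partial4 Psi i j r s).
  exact: function_of_difference_dx oX (D3 j r s).
set H := hess Psi (x - y).
have uH : H \in unitmx by apply: posdefmx_unit; exact: pos.
have mixedE : \matrix_(i, j) dx i (dy j c) x y = (- 1) *: H.
  by apply/matrixP => i j; rewrite !mxE CN2 // mulN1r.
have uN : (- 1) *: H \in unitmx by rewrite unitmxZ // unitrN1.
have invE : invmx (\matrix_(i, j) dx i (dy j c) x y) = - invmx H.
  by rewrite mixedE invmxZ // invrN1 scaleN1r.
have hN r : (- invmx H *m eta)^T 0 r = - h 0 r by rewrite mulNmx !mxE.
clearbody h.
rewrite /MTW invE; apply: eq_bigr => i _; apply: eq_bigr => j _.
apply: (etrans (sum_raise _ _ _ _ _)).
apply: eq_bigr => r _; apply: eq_bigr => s _.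
have signs (w w' a b d e : R) : w = w' ->
    w * a * b * - d * - e = w' * a * b * d * e by move=> ->; ring.
rewrite !hN; apply: signs.
apply: (congr2 (fun a b : R => a - b)); last exact: (D4 i j r s x y Xx Yy).
apply: eq_bigr => p _; apply: eq_bigr => q _.
have product (a a' k d d' : R) : a = - a' -> d = d' ->
    a * - k * d = a' * k * d' by move=> -> ->; ring.
rewrite mxE; apply: product; [exact: CN3 | exact: D3].
Qed.

(** Once all sums are reindexed so that i and q carry xi while j and k carry h,
    the identity holds coefficient by coefficient. *)
Lemma cross_curvature_identity (R : realType) (n : nat)
    (Q F : 'I_n -> 'I_n -> 'I_n -> 'I_n -> R) (xi h : 'rV[R]_n) :
  (forall i j k l, Q i j k l = Q k l i j) ->
  \sum_i \sum_j \sum_r \sum_s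
    (Q i j r s - F i j r s) * xi 0 i * xi 0 j * h 0 r * h 0 s
  = 2 * (\sum_i \sum_j \sum_k \sum_q
      (- 2^-1 * F i q j k + 4^-1 * (Q i q j k + Q j q i k))
      * xi 0 i * h 0 j * h 0 k * xi 0 q)
    - 2 * (\sum_i \sum_j \sum_k \sum_q
      (- 4^-1 * (Q i q j k - Q j q i k))
      * h 0 i * xi 0 j * xi 0 k * h 0 q).
Proof.
move=> symQ.
have -> : \sum_i \sum_j \sum_k \sum_q
      (- 4^-1 * (Q i q j k - Q j q i k)) * h 0 i * xi 0 j * xi 0 k * h 0 q
    = \sum_i \sum_j \sum_k \sum_q
      (- 4^-1 * (Q j k i q - Q i k j q)) * h 0 j * xi 0 i * xi 0 q * h 0 k.
  rewrite exchange_big; apply: eq_bigr => i _; apply: eq_bigr => j _.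
  exact: exchange_big.
rewrite !mulr_sumr -sumrB; apply: eq_bigr => i _.
transitivity (\sum_j \sum_k \sum_q
    (Q i q j k - F i q j k) * xi 0 i * xi 0 q * h 0 j * h 0 k).
  rewrite exchange_big; apply: eq_bigr => j _; exact: exchange_big.
rewrite !mulr_sumr -sumrB; apply: eq_bigr => j _.
rewrite !mulr_sumr -sumrB; apply: eq_bigr => k _.
rewrite !mulr_sumr -sumrB; apply: eq_bigr => q _.
by rewrite (symQ j k i q) (symQ i k j q); field.
Qed.

Lemma MTW_sasaki_curvature (R : realType) (n : nat) (X Y M : set 'rV[R]_n)
    (Psi : 'rV[R]_n -> R) (c : 'rV[R]_n -> 'rV[R]_n -> R)
    (x y xi v : 'rV[R]_n) (eta : 'cV[R]_n) :
  open X -> open Y -> is_Psi_cost X Y M Psi c -> X x -> Y y ->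
  let Rm := riemann (sasaki Psi) (row_mx (x - y) v) in
  let A := extend xi in
  let B := extend (sharp Psi (x - y) eta) in
  MTW c x y xi eta
    = 2 * Rm A (sasaki_J B) A (sasaki_J B) - 2 * Rm B A B A.
Proof.
move=> oX oY cost Xx Yy Rm A B; rewrite /Rm {Rm}.
rewrite (psi_cost_MTW _ _ oX oY cost Xx Yy).
have [oM subM _ CPsi pos cE] := cost.
set u := x - y.
have Mu : M u by apply: subM; exists x => //; exists y.
have Mp : M (lsubmx (row_mx u v)) by rewrite row_mxKl.
set h := sharp Psi u eta.
have -> : sasaki_J B = row_mx 0 h.
  by rewrite /sasaki_J /B /extend row_mxKr row_mxKl oppr0.
rewrite /A /B /extend.
rewrite (riemann_mixed oM CPsi pos _ _ _ _ Mp).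
rewrite (riemann_horizontal oM CPsi pos _ _ _ _ Mp).
apply: etrans (cross_curvature_identity _ _ _ _) _.
  exact: (contract_partial3_swap oM CPsi Mu).
have lsubp : lsubmx (row_mx u v) = u by exact: row_mxKl.
have sum4 (E E' : 'I_n -> 'I_n -> 'I_n -> 'I_n -> R) :
    (forall i j k q, E i j k q = E' i j k q) ->
    \sum_i \sum_j \sum_k \sum_q E i j k q
    = \sum_i \sum_j \sum_k \sum_q E' i j k q.
  by move=> EE; do 4!apply: eq_bigr => ? _.
congr (2 * _ - 2 * _); apply: sum4 => i j k q.
  by rewrite (lowered_curv_mixed oM CPsi pos _ _ _ _ Mp) lsubp.
by rewrite (lowered_curv_horizontal oM CPsi pos _ _ _ _ Mp) lsubp.
Qed.

Theorem theorem6 (R : realType) (n : nat) (X Y M : set 'rV[R]_n)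
    (Psi : 'rV[R]_n -> R) (c : 'rV[R]_n -> 'rV[R]_n -> R)
    (openX : open X) (openY : open Y) (cost_c : is_Psi_cost X Y M Psi c) :
  (forall (x y xi : 'rV[R]_n) (eta : 'cV[R]_n) (v : 'rV[R]_n),
     X x -> Y y -> pairing eta xi = 0 ->
     let Rm := riemann (sasaki Psi) (row_mx (x - y) v) in
     let A := extend xi in
     let B := extend (sharp Psi (x - y) eta) in
     MTW c x y xi eta
       = 2 * Rm A (sasaki_J B) A (sasaki_J B) - 2 * Rm B A B A)
  /\
  (forall (x y xi : 'rV[R]_n) (eta : 'cV[R]_n) (v : 'rV[R]_n),
     X x -> Y y ->
     let Rm := riemann (sasaki Psi) (row_mx (x - y) v) in
     let A := extend xi in
     let B := extend (sharp Psi (x - y) eta) in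
     MTW c x y xi eta
       = 2 * Rm A (sasaki_J B) A (sasaki_J B) - 2 * Rm B A B A).
Proof.
by split=> [x y xi eta v Xx Yy _|x y xi eta v Xx Yy];
  exact: MTW_sasaki_curvature openX openY cost_c Xx Yy.
Qed.
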